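(* Let $n, d\geq 1$ be positive integers and let $S\subseteq \mathbb{Z}^n$ be a finite generating set of the group $\mathbb{Z}^n$. Suppose that for each $g\in S$, the set $\{1\leq i\leq n: \pi_i(g)\neq 0\}$ has size either $1$ or $n$. Then there is a positive integer $\Delta\geq d$ and a clopen subset $M\subseteq F(2^{\mathbb{Z}^n})$ such that (1) for any distinct $x,y\in M$ in the same orbit, $\rho(x,y)\geq d$; (2) for any $g\in S$ and any $x\in F(2^{\mathbb{Z}^n})$, there are non-negative integers $a,b\leq \Delta$ such that $ag\cdot x\in M$ and $-bg\cdot x\in M$.
   Context: $2^{\mathbb{Z}^n}=\{0,1\}^{\mathbb{Z}^n}$ carries the product topology (with $\{0,1\}$ discrete), and $\mathbb{Z}^n$ acts on it by the Bernoulli shift $(g\cdot x)(h)=x(g+h)$ for $g,h\in\mathbb{Z}^n$. The free part is $F(2^{\mathbb{Z}^n})=\{x\in 2^{\mathbb{Z}^n}: \forall g\in\mathbb{Z}^n\ (g\neq \overline{0}\Rightarrow g\cdot x\neq x)\}$, with the subspace topology; ''clopen'' means clopen in $F(2^{\mathbb{Z}^n})$. The orbit of $x$ is $[x]=\{g\cdot x: g\in\mathbb{Z}^n\}$. For $g\in\mathbb{Z}^n$, $\|g\|=\max_{1\leq i\leq n}|g(i)|$, and $\pi_i(g)=g(i)$ is the $i$-th coordinate of $g$. For $x,y\in F(2^{\mathbb{Z}^n})$ in the same orbit, $\rho(x,y)=\|g\|$ where $g$ is the unique element of $\mathbb{Z}^n$ with $g\cdot x=y$. For an integer $a$ and $g\in\mathbb{Z}^n$,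 $ag$ is the scalar multiple in $\mathbb{Z}^n$. *)

(* Defs.v *)
From mathcomp Require Import all_boot all_order all_algebra.
From mathcomp Require Import all_classical all_reals all_analysis.

Set Implicit Arguments.
Unset Strict Implicit.
Unset Printing Implicit Defensive.

Import GRing.Theory.
Local Open Scope classical_set_scope.
Local Open Scope ring_scope.

Definition generated_subgroup (V : zmodType) (S : set V) : set V :=
  smallest (fun H : set V => zmod_closed [in H]) S.

Definition sup_norm (n : nat) (g : 'rV[int]_n) : nat :=
  (\max_(i < n) `|g ord0 i|)%N.

Definition coord_support (n : nat) (g : 'rV[int]_n) : {pred 'I_n} :=
  [pred i | g ord0 i != 0].

(* `prod_topology` puts the product topology on the function type, and the
   library's topology on `bool` is the discrete one. *)
Definition bernoulli_space (n : nat) : topologicalType :=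
  prod_topology (fun _ : 'rV[int]_n => bool).

Definition bernoulli_shift (n : nat) (g : 'rV[int]_n) (x : bernoulli_space n) :
  bernoulli_space n := fun h => x (g + h).

Definition free_part (n : nat) : set (bernoulli_space n) :=
  [set x | forall g : 'rV[int]_n, g <> 0 -> bernoulli_shift g x <> x].
Arguments free_part n : clear implicits.

Section Shift.
Context (n : nat).
Implicit Types (g h : 'rV[int]_n) (x : bernoulli_space n).

Lemma shift0 x : bernoulli_shift 0 x = x.
Proof. by apply/funext => k; rewrite /bernoulli_shift add0r. Qed.

Lemma shiftD g h x :
  bernoulli_shift (g + h) x = bernoulli_shift g (bernoulli_shift h x).
Proof. by apply/funext => k; rewrite /bernoulli_shift addrA [h + g]addrC. Qed.

Lemma shiftC g h x :
  bernoulli_shift g (bernoulli_shift h x) =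
  bernoulli_shift h (bernoulli_shift g x).
Proof. by rewrite -!shiftD addrC. Qed.

Lemma shiftK g : cancel (@bernoulli_shift n g) (bernoulli_shift (- g)).
Proof. by move=> x; rewrite -shiftD addNr shift0. Qed.

Lemma free_part_shift g x :
  x \in free_part n -> bernoulli_shift g x \in free_part n.
Proof.
move=> /set_mem Fx; apply/mem_set => h h0; rewrite shiftC.
move=> /(can_inj (shiftK g)).
exact: Fx h0.
Qed.

End Shift.

(* Sets coerce to types through `set_type`, which carries the subspace
   topology, so `x : free_part n` is a point of the free part. *)
Definition free_shift (n : nat) (g : 'rV[int]_n) (x : free_part n) :
  free_part n :=
  exist _ (bernoulli_shift g (val x)) (free_part_shift g (valP x)).

Definition shift_orbit (n : nat) (x : free_part n) : set (free_part n) :=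
  [set free_shift g x | g in [set: 'rV[int]_n]].

(* Only meaningful when `y` is in the orbit of `x` (see `rho_shift`); the
   junk value is 0 otherwise. *)
Definition rho (n : nat) (x y : free_part n) : nat :=
  sup_norm (xget 0 [set g : 'rV[int]_n | free_shift g x = y]).

Lemma free_shift_inj (n : nat) (x : free_part n) :
  injective (fun g : 'rV[int]_n => free_shift g x).
Proof.
move=> g h /(congr1 val) /= gh; apply/eqP; rewrite -subr_eq0; apply/eqP.
apply: contrapT => gh0; have /set_mem /(_ _ gh0) := valP x; apply.
by rewrite addrC shiftD gh shiftK.
Qed.

Lemma rho_shift (n : nat) (x : free_part n) (g : 'rV[int]_n) :
  rho x (free_shift g x) = sup_norm g.
Proof.
by rewrite /rho; case: xgetP => [h _ /free_shift_inj -> //|/(_ g)] /(_ erefl).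
Qed.

(* Main.v *)
From HB Require Import structures.
Require Import Defs.
From mathcomp Require Import all_boot all_order all_algebra.
From mathcomp Require Import all_classical all_reals all_analysis.
From mathcomp Require Import finmap zify ring.
Set Implicit Arguments.
Unset Strict Implicit.
Unset Printing Implicit Defensive.
Import Order.TTheory GRing.Theory Num.Theory.
Local Open Scope classical_set_scope.
Local Open Scope ring_scope.

(** The marker set is produced by cutting each orbit, identified with Z^n, into
    bounded regions whose boundaries are pieces of Euclidean spheres, and by
    putting a coset of a lattice inside each region, away from its boundary.

    Take a clopen set of centres that is [s]-separated and [s]-covering for the
    sup norm ([clopen_separated_covering]), and attach to a point [y] of the
    orbit the finite nonempty set [P y] of the centres in its Euclidean ball of
    radius [s * sqrt n]. Fix [e] at least [d] and at least the norms of
    the vectors of [S]. Say that [y] is stable when [P] is constant on the ball of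
    sup-norm radius [e] around [y], and that [y] is marked when it is stable and
    the phase [\sum_(p in P y) phi (y - p)] is divisible by [m]. Here [phi] is an
    additive form and [m] a prime that divides neither [phi h] for a short
    nonzero [h] nor any number [#|P y|] ([phase_parameters]).

    As long as [P] does not change, a displacement by [h] adds [#|P y| * phi h]
    to the phase, and this is nonzero modulo [m] when [h] is short. Hence two
    marked points are never within distance [e] ([marked_far]), and [m]
    consecutive stable points of a line in a short direction [g] contain a
    marked one ([marked_in_block]).

    It remains to see that a line cannot stay unstable. If [y + t g] is unstable
    then it lies in a thin shell around the sphere of some centre [p]
    ([unstable_shell]); the squared distance from [y + t g] to [p] is a quadratic
    polynomial in [t] whose leading coefficient is at least [1], while the width
    of the shell, measured on squared distances, is only linear in [s]. So each
    centre spoils times in at most two short windows ([shell_times]): a line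
    crosses a sphere quickly because the sphere is curved, whatever the direction
    of the line. The number of centres that matter along a piece of line of length
    about [s] depends on [n] alone ([separated_cells]), hence some long block of
    consecutive times is entirely stable ([stable_block]).

    Whether a point is marked depends on finitely many values of the indicator of
    the set of centres, so the marked points form a clopen set
    ([clopen_line_marker]). *)

(** * Sup norm and Euclidean norm on Z^n *)

Section SupNorm.
Context (n : nat).
Implicit Types (g h v : 'rV[int]_n) (k : nat).

(* `mxE` leaves the entries at an unfolded form of the type `int`, which the
   arithmetic tactics do not recognise; these variants keep it folded. *)
Lemma coordD g h i : (g + h) ord0 i = g ord0 i + h ord0 i :> int.
Proof. by rewrite mxE. Qed.

Lemma coordN g i : (- g) ord0 i = - g ord0 i :> int.
Proof. by rewrite mxE. Qed.

Lemma coordZ (t : int) g i : (t *: g) ord0 i = t * g ord0 i :> int.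
Proof. by rewrite mxE. Qed.

Lemma sup_normP g k :
  reflect (forall i, (`|g ord0 i| <= k)%N) (sup_norm g <= k)%N.
Proof.
by apply: (iffP (bigmax_leqP _ _ _)) => le_gk i; [exact: le_gk|move=> _; exact: le_gk].
Qed.

Lemma leq_sup_norm g i : (`|g ord0 i| <= sup_norm g)%N.
Proof. exact/(sup_normP g _)/leqnn. Qed.

Lemma sup_normD g h : (sup_norm (g + h)%R <= sup_norm g + sup_norm h)%N.
Proof.
apply/sup_normP => i; rewrite coordD.
by have := leq_sup_norm g i; have := leq_sup_norm h i; lia.
Qed.

Lemma sup_normN g : sup_norm (- g) = sup_norm g.
Proof. by apply: eq_bigr => i _; rewrite coordN abszN. Qed.

Lemma sup_normZ (t : nat) g : (sup_norm (t%:Z *: g) <= t * sup_norm g)%N.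
Proof.
apply/sup_normP => i; rewrite coordZ abszM absz_nat leq_mul2l.
by rewrite leq_sup_norm orbT.
Qed.

Lemma sup_norm_eq0 g : (sup_norm g == 0)%N = (g == 0).
Proof.
apply/eqP/eqP => [g0|->]; last first.
  by apply/eqP; rewrite -leqn0; apply/sup_normP => i; rewrite mxE.
apply/rowP => i; rewrite mxE; apply/eqP.
by have := leq_sup_norm g i; rewrite g0 leqn0 absz_eq0.
Qed.

Lemma sup_norm_ball k :
  exists s : seq 'rV[int]_n, forall v, (v \in s) = (sup_norm v <= k)%N.
Proof.
pose B := [set v : 'rV[int]_n | (sup_norm v <= k)%N].
suff /finite_seqP[s Bs] : finite_set B.
  by exists s => v; apply/idP/idP => [vs|vk]; [have : B v by rewrite Bs
    | have : B v by []; rewrite Bs].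
pose vec (f : {ffun 'I_n -> 'I_(2 * k).+1}) : 'rV[int]_n :=
  \row_i ((f i)%:Z - k%:Z).
apply: (@sub_finite_set _ _ (range vec)); last exact: finite_image.
move=> v /sup_normP vk; exists [ffun i => inord (absz (v ord0 i + k%:Z))] => //.
apply/rowP => i; move: (vk i); rewrite mxE ffunE.
by move: (v ord0 i : int) => z zk; rewrite inordK; lia.
Qed.

Definition sqnorm v : int := \sum_i (v ord0 i) ^+ 2.

Lemma sqnorm_gt0 v : v != 0 -> 1 <= sqnorm v.
Proof.
move=> v0; rewrite -gtz0_ge1 lt_neqAle sumr_ge0 ?andbT; last first.
  by move=> i _; exact: sqr_ge0.
apply: contra v0; rewrite eq_sym psumr_eq0; last by move=> i _; exact: sqr_ge0.
move=> /allP v0; apply/eqP/rowP => i; rewrite mxE; apply/eqP.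
by have := v0 i (mem_index_enum i); rewrite sqrf_eq0.
Qed.

Lemma sqnorm_le v k : (sup_norm v <= k)%N -> sqnorm v <= (n * k ^ 2)%N%:Z.
Proof.
move=> /sup_normP vk; rewrite -[n in leRHS]card_ord -sum_nat_const.
rewrite /sqnorm -[leRHS]/(Posz _) (big_morph _ PoszD (erefl _)).
by apply: ler_sum => i _; have := vk i; rewrite expr2; nia.
Qed.

Lemma sup_norm_le_sqnorm v k : sqnorm v <= (k ^ 2)%N%:Z -> (sup_norm v <= k)%N.
Proof.
move=> vk; apply/sup_normP => i.
have : (v ord0 i) ^+ 2 <= sqnorm v.
  by rewrite /sqnorm (bigD1 i)//= lerDl sumr_ge0// => j _; exact: sqr_ge0.
move: vk; rewrite expr2; nia.
Qed.

(** On the ball of radius [k] the squared norm varies by [O(e * k)] over a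
    distance [e]: this is what makes the shells around the spheres thin. *)
Lemma sqnorm_perturb v h k e :
  (sup_norm v <= k)%N -> (sup_norm h <= e)%N ->
  `|sqnorm (v + h) - sqnorm v| <= (n * (e * (2 * k + e)))%N%:Z.
Proof.
move=> /sup_normP vk /sup_normP he; rewrite /sqnorm -sumrB.
apply: (le_trans (ler_norm_sum _ _ _)).
rewrite -[n in leRHS]card_ord -sum_nat_const.
rewrite -[leRHS]/(Posz _) (big_morph _ PoszD (erefl _)).
apply: ler_sum => i _; rewrite coordD.
have -> : (v ord0 i + h ord0 i) ^+ 2 - v ord0 i ^+ 2 =
  h ord0 i * (2 * v ord0 i + h ord0 i) by ring.
rewrite normrM PoszM ler_pM//; first by have := he i; lia.
by have := he i; have := vk i; lia.
Qed.

(** Along a line the squared norm is a quadratic polynomial with leading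
    coefficient [sqnorm g]; this is its second divided difference, cleared of
    denominators. *)
Lemma sqnorm_second_difference v g (t1 t2 t3 : int) :
  (t3 - t2) * sqnorm (v + t1 *: g) - (t3 - t1) * sqnorm (v + t2 *: g)
    + (t2 - t1) * sqnorm (v + t3 *: g) =
  (t2 - t1) * (t3 - t2) * (t3 - t1) * sqnorm g.
Proof.
rewrite /sqnorm !mulr_sumr -sumrB -big_split /=; apply: eq_bigr => i _.
by rewrite !coordD !coordZ; ring.
Qed.

(** A quadratic polynomial with leading coefficient at least [1] cannot be within
    [W] of the same value at three times that are more than [sqrt (2 W)] apart. *)
Lemma shell_times v g (c : int) (W l t1 t2 t3 : nat) :
  g != 0 -> (t1 + l < t2)%N -> (t2 + l < t3)%N -> (2 * W < l ^ 2)%N ->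
  `|sqnorm (v + t1%:Z *: g) - c| <= W%:Z ->
  `|sqnorm (v + t2%:Z *: g) - c| <= W%:Z ->
  `|sqnorm (v + t3%:Z *: g) - c| <= W%:Z -> False.
Proof.
move=> g0 t12 t23 Wl.
have := sqnorm_second_difference v g t1 t2 t3.
have := sqnorm_gt0 g0.
move: (sqnorm _) (sqnorm _) (sqnorm _) (sqnorm g) => f3 f2 f1 A A1 E H1 H2 H3.
pose a := t2%:Z - t1%:Z; pose b := t3%:Z - t2%:Z.
have al : l%:Z < a by rewrite /a; lia.
have bl : l%:Z < b by rewrite /b; lia.
(* The second difference kills constants, so `c` may be subtracted. *)
have {}E : b * (f1 - c) - (a + b) * (f2 - c) + a * (f3 - c) =
    a * b * (a + b) * A.
  transitivity ((t2%:Z - t1%:Z) * (t3%:Z - t2%:Z) * (t3%:Z - t1%:Z) * A).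
    by rewrite -E /a /b; ring.
  by rewrite /a /b; ring.
have l0 : 0 <= l%:Z by [].
have ab : (2 * W)%N%:Z < a * b by rewrite (lt_trans (y := (l ^ 2)%N%:Z))//; nia.
have up : a * b * (a + b) * A <= (a + b) * (2 * W)%N%:Z.
  rewrite -E; move: H1 H2 H3; rewrite !ler_norml.
  move=> /andP[_ H1] /andP[H2 _] /andP[_ H3].
  have h1 : b * (f1 - c) <= b * W%:Z by rewrite ler_wpM2l//; lia.
  have h2 : (a + b) * - W%:Z <= (a + b) * (f2 - c) by rewrite ler_wpM2l//; lia.
  have h3 : a * (f3 - c) <= a * W%:Z by rewrite ler_wpM2l//; lia.
  by rewrite PoszM; nia.
have : (a + b) * (2 * W)%N%:Z < (a + b) * (a * b) by rewrite ltr_pM2l//; lia.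
suff : (a + b) * (a * b) <= a * b * (a + b) * A by lia.
by rewrite [X in X <= _](_ : _ = a * b * (a + b) * 1) ?ler_wpM2l//; [nia|ring].
Qed.

(** The Euclidean ball of radius [s * sqrt n] contains the sup-norm ball of radius
    [s]; this is the rough converse inclusion. *)
Lemma sup_norm_ball_radius s v :
  sqnorm v <= (n * s ^ 2)%N%:Z -> (sup_norm v <= n * s)%N.
Proof.
move=> vn; apply: sup_norm_le_sqnorm; apply: le_trans vn _.
by rewrite lez_nat expnMn leq_mul2r -mulnn; nia.
Qed.

End SupNorm.

(** * Counting and congruences *)

Lemma leq_card_fset_inj (T : choiceType) (F : finType) (A : {fset T})
  (f : T -> F) : {in A &, injective f} -> (#|` A| <= #|F|)%N.
Proof.
move=> f_inj; rewrite -(size_map f) cardE; apply: uniq_leq_size.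
  by rewrite map_inj_in_uniq// fset_uniq.
by move=> y _; rewrite mem_enum.
Qed.

Lemma pigeonhole3 (F : finType) (N : nat) (f : 'I_(2 * N).+1 -> F) :
  (#|F| <= N)%N ->
  exists i j k : 'I_(2 * N).+1, [/\ (i < j)%N, (j < k)%N, f i = f j & f j = f k].
Proof.
move=> FN; have [y] : exists y, (2 < #|[pred i | f i == y]|)%N.
  apply: contrapT => no_y.
  have : (#|'I_(2 * N).+1| <= \sum_(y : F) 2)%N.
    rewrite -sum1_card (partition_big f xpredT)//=; apply: leq_sum => y _.
    rewrite sum1dep_card leqNgt; apply/negP => yy; apply: no_y; exists y.
    by rewrite cardsE in yy.
  by rewrite card_ord sum_nat_const leqNgt ltnS mulnC leq_mul2l FN.
case/card_gt2P => i [j [k []]]; rewrite !inE => -[/eqP fi /eqP fj /eqP fk].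
rewrite -!(inj_eq val_inj)/= => -[ij jk ki].
have sorted_triple (a b c : 'I_(2 * N).+1) : (a < b)%N -> (b < c)%N ->
    f a = y -> f b = y -> f c = y ->
    exists i j k : 'I_(2 * N).+1,
      [/\ (i < j)%N, (j < k)%N, f i = f j & f j = f k].
  by move=> ab bc fa fb fc; exists a, b, c; rewrite fa fb fc.
have : (((i < j) && (j < k)) || ((i < k) && (k < j)) || ((j < i) && (i < k)) ||
  ((j < k) && (k < i)) || ((k < i) && (i < j)) || ((k < j) && (j < i)))%N.
  by lia.
by case/orP=> [/orP[/orP[/orP[/orP[]|]|]|]|] /andP[ab bc];
  apply: sorted_triple ab bc _ _ _.
Qed.

Lemma prime_progression (m : nat) (c u : int) : prime m -> ~~ (m%:Z %| u)%Z ->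
  exists2 j : nat, (j < m)%N & (m%:Z %| c + u *+ j)%Z.
Proof.
move=> m_pr mu.
have m0 : m%:Z != 0 by have := prime_gt0 m_pr; lia.
have cop : coprimez m u by rewrite coprimezE prime_coprime// -dvdzE.
have [[a b] ab] : exists ab : int * int, ab.1 * m%:Z + ab.2 * u = 1.
  by have [a [b ab]] := Bezoutz m%:Z u; exists (a, b); rewrite /= ab; exact/eqP.
pose j := (- c * b %% m%:Z)%Z.
have j0 : 0 <= j by rewrite modz_ge0.
exists (absz j); first by have := ltz_mod (- c * b) m0; rewrite -/j; lia.
have -> : u *+ absz j = u * j by rewrite pmulrn mulrzz gez0_abs.
set q := (- c * b %/ m%:Z)%Z.
have jE : j = - c * b - q * m%:Z by rewrite {1}(divz_eq (- c * b) m%:Z) addrC addKr.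
have -> : c + u * j = (c * a - u * q) * m%:Z.
  by rewrite -{1}[c]mulr1 -ab jE; ring.
exact: dvdz_mull.
Qed.

Lemma prime_ndvd_mulrn (m K : nat) (u : int) : prime m -> (0 < K < m)%N ->
  ~~ (m%:Z %| u)%Z -> ~~ (m%:Z %| u *+ K)%Z.
Proof.
move=> m_pr /andP[K0 Km]; rewrite pmulrn mulrzz !dvdzE abszM Euclid_dvdM//.
by rewrite negb_or => -> /=; rewrite gtnNdvd.
Qed.

(** * Centres, stability and phase *)

Section Centers.
Context (n : nat).
Implicit Types (D : set 'rV[int]_n) (g h p v y z : 'rV[int]_n).

Definition ball_centers (r2 : nat) D y : set 'rV[int]_n :=
  [set p | D p /\ sqnorm (y - p) <= r2%:Z].

Definition stable (r2 e : nat) D y : Prop :=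
  forall h, (sup_norm h <= e)%N ->
    ball_centers r2 D (y + h) = ball_centers r2 D y.

(** The sum over all the centres near [y], rather than a choice of one of them,
    makes the phase commute with translations. *)
Definition phase (phi : {additive 'rV[int]_n -> int}) (r2 : nat) D y : int :=
  \sum_(p \in ball_centers r2 D y) phi (y - p).

Definition marked (phi : {additive 'rV[int]_n -> int}) (m r2 e : nat) D :=
  [set y | stable r2 e D y /\ (m%:Z %| phase phi r2 D y)%Z].

Definition separated (s : nat) D :=
  forall p q, D p -> D q -> (sup_norm (p - q) <= s)%N -> p = q.

Definition covering (s : nat) D :=
  forall y, exists2 p, D p & (sup_norm (y - p) <= s)%N.

Lemma finite_ball_centers r2 D y : finite_set (ball_centers r2 D y).
Proof.
have [s sP] := sup_norm_ball n r2.
apply: (@sub_finite_set _ _ ((fun v => y - v) @` [set` s])); last first.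
  exact/finite_image/finite_seq.
move=> p [_ pr]; exists (y - p); last by rewrite opprB addrC subrK.
rewrite /= sP; apply: sup_norm_le_sqnorm; apply: le_trans pr _.
by rewrite lez_nat -mulnn; nia.
Qed.

Lemma phase_step phi r2 D y y' :
  ball_centers r2 D y' = ball_centers r2 D y ->
  phase phi r2 D y' =
    phase phi r2 D y + phi (y' - y) *+ #|` fset_set (ball_centers r2 D y)|.
Proof.
rewrite /phase => ->; have finP := finite_ball_centers r2 D y.
rewrite !fsbig_finite//=.
rewrite -iter_addr_0 -(count_predT (fset_set _)) -(big_const_seq 0 +%R).
rewrite -big_split /=; apply: eq_bigr => p _; rewrite -raddfD; congr (phi _).
by rewrite [RHS]addrC addrA subrK.
Qed.

(** Cutting a cube of side [2 * c * s] into cells of side [s] leaves at most one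
    point of an [s]-separated set in each cell, so the number of these points is
    bounded independently of [s]. *)
Lemma separated_cells (c s : nat) D y : (0 < s)%N -> separated s D ->
  exists cell : 'rV[int]_n -> {ffun 'I_n -> 'I_(2 * c).+1},
    forall p q, D p -> D q -> (sup_norm (y - p)%R <= c * s)%N ->
      (sup_norm (y - q)%R <= c * s)%N -> cell p = cell q -> p = q.
Proof.
move=> s0 sepD.
exists (fun p => [ffun i => inord (absz ((y - p) ord0 i + (c * s)%N%:Z) %/ s)]).
move=> p q Dp Dq /sup_normP py /sup_normP qy /ffunP pq; apply: sepD => //.
apply/sup_normP => i; have := pq i; rewrite !ffunE => /(congr1 val) /=.
have -> : (p - q) ord0 i = (y - q) ord0 i - (y - p) ord0 i :> int.
  by rewrite -coordN -coordD opprB [in RHS]addrC subrKA.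
move: (py i) (qy i); move: ((y - p) ord0 i : int) ((y - q) ord0 i : int).
move=> a b ac bc.
have cell_lt (x : int) : (absz x <= c * s)%N ->
    (absz (x + (c * s)%N%:Z)%R %/ s < (2 * c).+1)%N.
  by move=> xc; rewrite ltnS -[X in (_ <= X)%N](mulnK _ s0) leq_div2r//; lia.
rewrite !inordK ?cell_lt// => E.
have := divn_eq (absz (a + (c * s)%N%:Z)) s; rewrite E.
have := divn_eq (absz (b + (c * s)%N%:Z)) s.
have := ltn_pmod (absz (a + (c * s)%N%:Z)) s0.
have := ltn_pmod (absz (b + (c * s)%N%:Z)) s0.
move: (_ %/ _)%N (_ %% _)%N (_ %% _)%N => k r1 r2.
lia.
Qed.

Lemma card_ball_centers (s : nat) D y : (0 < s)%N -> separated s D ->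
  (#|` fset_set (ball_centers (n * s ^ 2) D y)| <= (2 * (n + 2)).+1 ^ n)%N.
Proof.
move=> s0 sepD; have [cell cell_inj] := separated_cells (n + 2) y s0 sepD.
have := @leq_card_fset_inj _ {ffun 'I_n -> 'I_(2 * (n + 2)).+1}
  (fset_set (ball_centers (n * s ^ 2) D y)) cell.
rewrite card_ffun !card_ord; apply => p q.
rewrite !in_fset_set; try exact: finite_ball_centers.
have near v : sqnorm v <= (n * s ^ 2)%N%:Z -> (sup_norm v <= (n + 2) * s)%N.
  by move=> /sup_norm_ball_radius/leq_trans; apply; rewrite leq_mul2r leq_addr orbT.
move=> /set_mem[Dp pn] /set_mem[Dq qn]; apply: cell_inj => //; exact: near.
Qed.

Lemma card_ball_centers_gt0 (s : nat) D y : covering s D ->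
  (0 < #|` fset_set (ball_centers (n * s ^ 2) D y)|)%N.
Proof.
move=> /(_ y)[p Dp yp]; rewrite cardfs_gt0; apply/fset0Pn; exists p.
rewrite in_fset_set; last exact: finite_ball_centers.
by apply/mem_set; split => //; exact: sqnorm_le.
Qed.

(** The bound of [sqnorm_perturb] on the ball of radius [n * s + e]; it is linear
    in [s] for fixed [e]. *)
Definition shell_width (s e : nat) := (n * (e * (2 * (n * s + e) + e)))%N.

(** If a displacement of length [e] changes the set of centres near [z], then [z]
    is close to the sphere around the centre that entered or left. *)
Lemma unstable_shell (s e : nat) D z : ~ stable (n * s ^ 2) e D z ->
  exists p, [/\ D p, (sup_norm (z - p)%R <= n * s + e)%N &
    `|sqnorm (z - p) - (n * s ^ 2)%N%:Z| <= (shell_width s e)%:Z].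
Proof.
apply: contra_notP => no_p h he; apply/seteqP.
have same_side p : D p -> (sqnorm (z + h - p) <= (n * s ^ 2)%N%:Z) =
                  (sqnorm (z - p) <= (n * s ^ 2)%N%:Z).
  move=> Dp; apply: contrapT => ne; apply: no_p; exists p.
  have zhp : z + h - p = z - p + h by rewrite addrAC.
  rewrite zhp in ne.
  have zpn : (sup_norm (z - p)%R <= n * s + e)%N.
    case: (leP (sqnorm (z - p)) (n * s ^ 2)%N%:Z) => zp.
      exact: leq_trans (sup_norm_ball_radius zp) (leq_addr _ _).
    have {ne} : sqnorm (z - p + h) <= (n * s ^ 2)%N%:Z.
      by apply: contrapT => /negP zph; apply: ne; rewrite (negbTE zph) leNgt zp.
    move=> /sup_norm_ball_radius zph; rewrite -[z - p](addrK h).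
    apply: leq_trans (sup_normD _ _) _.
    by rewrite sup_normN leq_add.
  split => //.
  have := sqnorm_perturb zpn he; rewrite -/(shell_width s e).
  move: ne; move: (sqnorm _) (sqnorm _) => a b ne ab.
  case: (leP a (n * s ^ 2)%N%:Z) ne; case: (leP b (n * s ^ 2)%N%:Z) => //; lia.
by split => p [Dp] /=; rewrite ?same_side//= => zp; split; rewrite ?same_side.
Qed.

(** One more than twice the number of cells that can hold a centre relevant to a
    piece of line, since each centre spoils at most two blocks. *)
Definition block_count := (2 * (2 * (n + 2)).+1 ^ n).+1.

(** The blocks are the times from [2 * i * l] to [2 * i * l + l - 1]; the gaps of
    length [l] between them put times from distinct blocks more than [l] apart.
    If every block contained an unstable time, some centre would be responsible
    for three blocks, which [shell_times] forbids. *)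
Lemma stable_block (s e l : nat) D g y : (0 < s)%N -> separated s D ->
  g != 0 -> (sup_norm g <= e)%N -> (e <= s)%N ->
  (2 * block_count * l * e <= s)%N -> (2 * shell_width s e < l ^ 2)%N ->
  exists2 i, (i < block_count)%N & forall j, (j < l)%N ->
    stable (n * s ^ 2) e D (y + (2 * i * l + j)%N%:Z *: g).
Proof.
move=> s0 sepD g0 ge es ls lW; apply: contrapT => unstable.
have {}unstable (i : 'I_block_count) : exists jp : nat * 'rV[int]_n,
    [/\ (jp.1 < l)%N, D jp.2,
      (sup_norm (y + (2 * i * l + jp.1)%N%:Z *: g - jp.2)%R <= n * s + e)%N &
      `|sqnorm (y + (2 * i * l + jp.1)%N%:Z *: g - jp.2) - (n * s ^ 2)%N%:Z| <=
        (shell_width s e)%:Z].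
  apply: contrapT => no_jp; apply: unstable; exists i => // j jl.
  apply: contrapT => /unstable_shell[p [Dp pn pW]]; apply: no_jp.
  by exists (j, p).
have [jp {}unstable] := choice unstable.
pose t (i : 'I_block_count) := (2 * i * l + (jp i).1)%N.
have tl i : (t i < 2 * block_count * l)%N.
  have [jl _ _ _] := unstable i; have := ltn_ord i; rewrite /t; nia.
have t_gap (i k : 'I_block_count) : (i < k)%N -> (t i + l < t k)%N.
  by have [jl _ _ _] := unstable i; rewrite /t; nia.
have [cell cell_inj] := separated_cells (n + 2) y s0 sepD.
(* All the centres involved lie in one cube of side proportional to `s`. *)
have near i : (sup_norm (y - (jp i).2)%R <= (n + 2) * s)%N.
  have [_ _ pn _] := unstable i.
  have -> : y - (jp i).2 = (y + (t i)%:Z *: g - (jp i).2) - (t i)%:Z *: g.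
    by rewrite [y + _ - _]addrAC addrK.
  apply: leq_trans (sup_normD _ _) _; rewrite sup_normN.
  have := sup_normZ (t i) g; rewrite -/(t i) in pn.
  have : (t i * sup_norm g <= 2 * block_count * l * e)%N.
    by rewrite leq_mul// ltnW// tl.
  by move: pn ls es; lia.
have [|i [j [k [ij jk]]]] := @pigeonhole3 {ffun 'I_n -> 'I_(2 * (n + 2)).+1}
  ((2 * (n + 2)).+1 ^ n) (fun i => cell (jp i).2).
  by rewrite card_ffun !card_ord.
have inj a b : cell (jp a).2 = cell (jp b).2 -> (jp a).2 = (jp b).2.
  have [_ Da _ _] := unstable a; have [_ Db _ _] := unstable b.
  exact: cell_inj.
move=> /inj pij /inj pjk.
have shell a : (jp a).2 = (jp i).2 ->
  `|sqnorm (y - (jp i).2 + (t a)%:Z *: g) - (n * s ^ 2)%N%:Z| <=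
        (shell_width s e)%:Z.
  by have [_ _ _ pW] := unstable a; rewrite addrAC => <-.
apply: (shell_times g0 (t_gap _ _ ij) (t_gap _ _ jk) lW (shell i _)
  (shell j _) (shell k _)) => //.
by rewrite pij.
Qed.

End Centers.

(** * Marked points are sparse and meet every line *)

Section Marked.
Context (n : nat) (phi : {additive 'rV[int]_n -> int}) (m s e : nat).
Hypothesis m_prime : prime m.
Hypothesis m_large : ((2 * (n + 2)).+1 ^ n < m)%N.
Hypothesis phi_nz : forall h : 'rV[int]_n, h != 0 -> (sup_norm h <= e)%N ->
  ~~ (m%:Z %| phi h)%Z.
Hypothesis s_gt0 : (0 < s)%N.
Context (D : set 'rV[int]_n).
Hypothesis sepD : separated s D.
Hypothesis covD : covering s D.
Implicit Types (g h y : 'rV[int]_n).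

Let r2 := (n * s ^ 2)%N.

Lemma phase_step_ndvd y h : h != 0 -> (sup_norm h <= e)%N ->
  ~~ (m%:Z %| phi h *+ #|` fset_set (ball_centers r2 D y)|)%Z.
Proof.
move=> h0 he; apply: prime_ndvd_mulrn => //; last exact: phi_nz.
rewrite card_ball_centers_gt0//=.
exact: leq_ltn_trans (card_ball_centers _ s_gt0 sepD) m_large.
Qed.

(** Stability of [y] equates the two sets of centres, and the two phases then
    differ by [phi h] times the number of centres, which [m] does not divide. *)
Lemma marked_far y h : h != 0 -> (sup_norm h <= e)%N ->
  marked phi m r2 e D y -> marked phi m r2 e D (y + h) -> False.
Proof.
move=> h0 he [st my] [_]; rewrite (phase_step phi (st h he)) [y + h]addrC addrK.
by rewrite (rpredDl _ my) (negbTE (phase_step_ndvd y h0 he)).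
Qed.

(** Along a block of stable points with step [g] of norm at most [e] the set of
    centres is constant, so the phase runs through an arithmetic progression
    whose difference is invertible modulo [m]. *)
Lemma marked_in_block y g t0 : g != 0 -> (sup_norm g <= e)%N ->
  (forall j, (j < m)%N -> stable r2 e D (y + (t0 + j)%N%:Z *: g)) ->
  exists2 j, (j < m)%N & marked phi m r2 e D (y + (t0 + j)%N%:Z *: g).
Proof.
move=> g0 ge st; pose z := y + t0%:Z *: g.
have zE j : y + (t0 + j)%N%:Z *: g = z + g *+ j.
  by rewrite PoszD scalerDl addrA -[j%:Z]natz scaler_nat.
have const j : (j < m)%N -> ball_centers r2 D (z + g *+ j) = ball_centers r2 D z.
  elim: j => [|j IHj] jm; first by rewrite mulr0n addr0.
  rewrite mulrSr addrA -(IHj (ltnW jm)); have := st j (ltnW jm).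
  by rewrite zE; apply.
have [j jm mj] := prime_progression (phase phi r2 D z) m_prime
  (phase_step_ndvd z g0 ge).
exists j => //; split; first exact: st.
rewrite zE (phase_step phi (const j jm)) [z + _]addrC addrK raddfMn.
by rewrite mulrnAC.
Qed.

Lemma marked_on_line y g : g != 0 -> (sup_norm g <= e)%N -> (e <= s)%N ->
  forall l, (m <= l)%N -> (2 * block_count n * l * e <= s)%N ->
  (2 * shell_width n s e < l ^ 2)%N ->
  exists2 t, (t <= 2 * block_count n * l)%N &
    marked phi m r2 e D (y + t%:Z *: g).
Proof.
move=> g0 ge es l ml ls lW.
have [i ib st] := stable_block y s_gt0 sepD g0 ge es ls lW.
have [j jm mj] := marked_in_block g0 ge (fun j jm => st j (leq_trans jm ml)).
exists (2 * i * l + j)%N => //; move: ib jm ml; move: (block_count n) => b; nia.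
Qed.

End Marked.

(** * Equivariance and locality of the marking *)

Section MarkedInvariance.
Context (n : nat) (phi : {additive 'rV[int]_n -> int}) (m r2 e : nat).
Implicit Types (g y : 'rV[int]_n) (D : set 'rV[int]_n).

Lemma ball_centers_translate D g y :
  ball_centers r2 D (y + g) =
  (fun p => p + g) @` ball_centers r2 (fun p => D (p + g)) y.
Proof.
apply/seteqP; split=> [p [Dp yp]|_ [p [Dp yp] <-]]; last first.
  by split; rewrite // opprD addrACA subrr addr0.
exists (p - g); last by rewrite subrK.
by split; rewrite ?subrK// opprB addrA.
Qed.

Lemma marked_translate D g :
  marked phi m r2 e (fun p => D (p + g)) 0 <-> marked phi m r2 e D g.
Proof.
have inj : injective (fun p : 'rV[int]_n => p + g) by exact: addIr.
have tr y : ball_centers r2 D (y + g) =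
  (fun p => p + g) @` ball_centers r2 (fun p => D (p + g)) y.
  exact: ball_centers_translate.
rewrite /marked /stable /phase /=.
rewrite -[g in X in _ <-> X]add0r.
have -> : \sum_(p \in ball_centers r2 D (0 + g)) phi (0 + g - p) =
    \sum_(p \in ball_centers r2 (fun p => D (p + g)) 0) phi (0 - p).
  rewrite tr fsbig_image; last by move=> p q _ _; exact: inj.
  by apply: eq_fsbigr => p _ /=; rewrite opprD addrACA subrr addr0.
split=> -[st mp]; split => // h he; have := st h he.
  by rewrite addrAC !tr => ->.
rewrite addrAC !tr => /seteqP[st1 st2]; apply/seteqP; split=> p Pp.
  by rewrite -(image_inj inj); apply: st1; exists p.
by rewrite -(image_inj inj); apply: st2; exists p.
Qed.

Lemma marked_local D D' :
  (forall p, (sup_norm p <= r2 + e)%N -> D p <-> D' p) ->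
  marked phi m r2 e D 0 -> marked phi m r2 e D' 0.
Proof.
move=> DD'.
have ballE h : (sup_norm h <= e)%N ->
    ball_centers r2 D' h = ball_centers r2 D h.
  move=> he; have near p : sqnorm (h - p) <= r2%:Z -> (sup_norm p <= r2 + e)%N.
    move=> hp; rewrite -[p](subKr h); apply: leq_trans (sup_normD _ _) _.
    rewrite sup_normN addnC leq_add//; apply: sup_norm_le_sqnorm.
    by apply: le_trans hp _; rewrite lez_nat -mulnn; nia.
  by apply/seteqP; split=> p [Dp hp]; split => //; move: Dp; rewrite DD'//; exact: near.
have sup0 : (sup_norm (0 : 'rV[int]_n) <= e)%N.
  by have /eqP -> : sup_norm (0 : 'rV[int]_n) == 0%N by rewrite sup_norm_eq0.
move=> [st mp]; split; last by rewrite /phase ballE.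
by move=> h he; have := st h he; rewrite !add0r !ballE.
Qed.

End MarkedInvariance.

(** * Choice of the parameters *)

(** With base [b > e] the coordinates of a vector of norm at most [e] act as
    signed digits, so the form vanishes on no short nonzero vector. *)
Definition digit_form (n b : nat) (h : 'rV[int]_n) : int :=
  \sum_i h ord0 i * b%:Z ^+ i.

Lemma digit_form_is_zmod_morphism n b : zmod_morphism (@digit_form n b).
Proof.
move=> g h; rewrite /digit_form -sumrB; apply: eq_bigr => i _.
by rewrite coordD coordN mulrBl.
Qed.

HB.instance Definition _ n b :=
  GRing.isZmodMorphism.Build 'rV[int]_n int (@digit_form n b)
    (@digit_form_is_zmod_morphism n b).

Lemma digit_form_eq0 n e (h : 'rV[int]_n) : (sup_norm h <= e)%N ->
  digit_form e.+1 h = 0 -> h = 0.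
Proof.
move=> /sup_normP he h0.
(* The coordinates vanish one after the other: if those of index below `k` do,
   then the base divides coordinate `k`, which is smaller than the base. *)
have lo k : forall i : 'I_n, (i < k)%N -> h ord0 i = 0.
  elim: k => // k IHk i; rewrite ltnS leq_eqVlt => /orP[/eqP ik|/IHk//].
  have b0 : (e.+1)%:Z ^+ k != 0 by rewrite expf_neq0.
  move: h0; rewrite /digit_form (bigD1 i)//= ik => /eqP; rewrite addr_eq0 => /eqP E.
  have : ((e.+1)%:Z ^+ k.+1 %| h ord0 i * (e.+1)%:Z ^+ k)%Z.
    rewrite E rpredN; apply: rpred_sum => j ji.
    have [jk|kj] := ltnP j k; first by rewrite IHk// mul0r dvdz0.
    apply: dvdz_mull; rewrite dvdz_exp2l// ltn_neqAle kj andbT -ik.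
    by rewrite eq_sym (inj_eq val_inj).
  rewrite exprS dvdz_mul2r// dvdzE.
  have [/eqP|hi0] := posnP (absz (h ord0 i)); first by rewrite absz_eq0 => /eqP.
  by move=> /(dvdn_leq hi0) /= lt; have := leq_trans lt (he i); rewrite ltnn.
by apply/rowP => i; rewrite mxE; exact: (lo n).
Qed.

Lemma phase_parameters n e : exists (phi : {additive 'rV[int]_n -> int}) m,
  [/\ prime m, ((2 * (n + 2)).+1 ^ n < m)%N &
    forall h, h != 0 -> (sup_norm h <= e)%N -> ~~ (m%:Z %| phi h)%Z].
Proof.
have [w wP] := sup_norm_ball n e.
pose K := (\max_(h <- w) `|digit_form e.+1 h|)%N.
have [m mK m_pr] := prime_above ((2 * (n + 2)).+1 ^ n + K)%N.
exists (@digit_form n e.+1), m; split => //.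
  exact: leq_ltn_trans (leq_addr _ _) mK.
move=> h h0 he; rewrite dvdzE gtnNdvd//.
  by rewrite lt0n absz_eq0; apply: contra_neq h0; exact: digit_form_eq0.
apply: leq_ltn_trans mK; apply: leq_trans (leq_addl _ _).
apply: (@leq_bigmax_seq _ w xpredT (fun h => absz (digit_form e.+1 h))) => //.
by rewrite wP.
Qed.

(** The requirement [2 * shell_width n s e < l ^ 2] can be met because the shell
    width is linear in [s] and [s] is taken linear in [l], whereas the right-hand
    side is quadratic. *)
Lemma scale_parameters n e m : (0 < n)%N -> (0 < e)%N -> exists s l : nat,
  [/\ (0 < s)%N, (e <= s)%N, (m <= l)%N & (e <= l)%N /\
     (2 * block_count n * l * e <= s)%N /\ (2 * shell_width n s e < l ^ 2)%N].
Proof.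
move=> n0 e0; pose b := block_count n.
have b0 : (0 < b)%N by [].
(* `c * l` bounds twice the shell width for `s` as chosen below. *)
pose c := (2 * n * e * (2 * n + 3) * (2 * b * e))%N.
pose l := (m + e + c).+1.
exists (2 * b * l * e)%N, l; rewrite -/b.
have el : (e <= 2 * b * l * e)%N by rewrite leq_pmull// !muln_gt0 b0.
split => //; first exact: leq_trans e0 el; first by rewrite /l; lia.
split; first by rewrite /l; lia.
split => //; rewrite -mulnn /shell_width.
apply: (@leq_ltn_trans (c * l)); last by rewrite ltn_pmul2r// /l; lia.
have -> : (c * l = 2 * (n * (e * (2 * (n * (2 * b * l * e)) + 3 * (2 * b * l * e)))))%N.
  by rewrite /c; ring.
rewrite !leq_mul2l; do 3![apply/orP; right].
by move: el; move: (2 * b * l * e)%N => u; lia.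
Qed.

(** * Clopen sets and maximal independent sets *)

Section Clopen.
Context (T : topologicalType).

(** A set whose membership is decided by finitely many clopen sets is a finite
    Boolean combination of them. *)
Lemma clopen_determined (I : eqType) (r : seq I) (C : I -> set T) (X : set T) :
  (forall i, i \in r -> clopen (C i)) ->
  (forall x y, (forall i, i \in r -> C i x <-> C i y) -> X x -> X y) ->
  clopen X.
Proof.
move=> Cclopen.
have atom_open x : open [set y | forall i, i \in r -> C i x <-> C i y].
  elim: r Cclopen => [|i r IHr] Cclopen.
    by rewrite (_ : mkset _ = setT); [exact: openT|exact/seteqP].
  have ir : i \in i :: r by rewrite mem_head.
  have [Co Cc] := Cclopen i ir.
  have -> : [set y | forall j, j \in i :: r -> C j x <-> C j y] =
      [set y | C i x <-> C i y] `&` [set y | forall j, j \in r -> C j x <-> C j y].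
    apply/seteqP; split=> y; first by move=> H; split=> [|j jr]; apply: H;
      rewrite ?mem_head// inE jr orbT.
    by move=> [yi yr] j; rewrite inE => /predU1P[->//|]; exact: yr.
  apply: openI; last by apply: IHr => j jr; apply: Cclopen; rewrite inE jr orbT.
  have [Cx|nCx] := pselect (C i x).
    by rewrite (_ : mkset _ = C i)//; apply/seteqP; split=> y /=; tauto.
  rewrite (_ : mkset _ = ~` C i); first exact: closed_openC.
  by apply/seteqP; split=> y /=; tauto.
have det_open (Y : set T) :
    (forall x y, (forall i, i \in r -> C i x <-> C i y) -> Y x -> Y y) -> open Y.
  move=> Ydet; have -> : Y = \bigcup_(x in Y)
      [set y | forall i, i \in r -> C i x <-> C i y].
    by apply/seteqP; split=> [y Yy|y [x Yx /Ydet]]; [exists y|exact].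
  by apply: bigcup_open => x _; exact: atom_open.
move=> Xdet; split; first exact: det_open.
rewrite -openC; apply: det_open => x y xy nXx Xy; apply: nXx.
by apply: Xdet Xy => i ir; split=> /xy; exact.
Qed.

(** The maps [f i] are the edges of a graph of finite degree on [T]. The greedy
    algorithm runs through a countable clopen cover [U] by independent sets, and
    adds at each step the points of [U k] that have no neighbour among those
    already taken. The result is open as an increasing union of clopen sets; it is
    closed because, by maximality and independence, its complement is the set of
    the points with a neighbour in it. *)
Lemma clopen_maximal_independent (I : eqType) (r : seq I) (f : I -> T -> T)
    (inv : I -> I) (U : nat -> set T) :
  (forall i, i \in r -> continuous (f i)) ->
  (forall i, i \in r -> inv i \in r /\ cancel (f i) (f (inv i))) ->
  (forall k, clopen (U k)) ->
  (forall k i x, i \in r -> U k x -> ~ U k (f i x)) ->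
  (forall x, exists k, U k x) ->
  exists D : set T, [/\ clopen D,
    forall i x, i \in r -> D x -> ~ D (f i x) &
    forall x, D x \/ exists2 i, i \in r & D (f i x)].
Proof.
move=> f_cont f_inv U_clopen U_indep U_cover.
pose A := fix A k : set T := if k is k'.+1 then
  A k' `|` (U k' `&` [set x | forall i, i \in r -> ~ A k' (f i x)]) else set0.
have A_clopen k : clopen (A k).
  elim: k => [|k IHk]; first exact: clopen0.
  apply: clopenU => //; apply: clopenI => //.
  apply: (@clopen_determined _ r (fun i => f i @^-1` A k)).
    by move=> i ir; apply: preimage_clopen => //; exact: f_cont.
  by move=> x y xy nA i ir /(xy i ir); exact: nA.
have A_mono k l : (k <= l)%N -> A k `<=` A l.
  by move=> /subnK <-; elim: (l - k)%N => //= j IHj x /IHj; left.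
have A_indep k i x : i \in r -> A k x -> ~ A k (f i x).
  elim: k i x => [//|k IHk] i x ir /= [Ax|[Ux nAx]] [Afx|[Ufx nAfx]].
  - exact: IHk Ax Afx.
  - by have [ri fK] := f_inv i ir; apply: (nAfx _ ri); rewrite fK.
  - exact: nAx Afx.
  - exact: U_indep Ux Ufx.
pose D := \bigcup_k A k.
have D_indep i x : i \in r -> D x -> ~ D (f i x).
  move=> ir [k _ Ax] [l _ Afx].
  apply: (A_indep (maxn k l) i x ir).
    exact: A_mono (leq_maxl _ _) _ Ax.
  exact: A_mono (leq_maxr _ _) _ Afx.
have D_max x : D x \/ exists2 i, i \in r & D (f i x).
  have [k Ux] := U_cover x.
  have [[i ir Afx]|no_i] := pselect (exists2 i, i \in r & A k (f i x)).
    by right; exists i => //; exists k.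
  left; exists k.+1 => //=; right; split => // i ir Afx.
  by apply: no_i; exists i.
have D_open : open D by apply: bigcup_open => k _; exact: (A_clopen k).1.
exists D; split => //; split => //; rewrite -openC.
have -> : ~` D = \bigcup_(i in [set` r]) (f i @^-1` D).
  apply/seteqP; split=> [x nDx|x [i ir Dfx] Dx]; last exact: D_indep Dx Dfx.
  by have [//|[i ir Dfx]] := D_max x; exists i.
by apply: bigcup_open => i ir; apply: open_comp => // x _; exact: f_cont.
Qed.

End Clopen.

(** * Markers on the free part *)

Section FreePart.
Context (n : nat).
Implicit Types (x y : free_part n) (g h v : 'rV[int]_n).

Lemma free_shift0 x : free_shift 0 x = x.
Proof. by apply: val_inj; rewrite /= Defs.shift0. Qed.

Lemma free_shiftD g h x : free_shift (g + h) x = free_shift g (free_shift h x).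
Proof. by apply: val_inj; rewrite /= Defs.shiftD. Qed.

Lemma continuous_coord h : continuous (fun x : free_part n => val x h : bool).
Proof.
move=> x; apply: (@continuous_comp _ _ _ (set_val : free_part n -> bernoulli_space n)
  (fun z => z h)); first exact: initial_continuous.
exact: (@proj_continuous _ (fun _ => bool) h).
Qed.

Lemma clopen_coord h (b : bool) : clopen [set x : free_part n | val x h = b].
Proof.
apply: (@preimage_clopen _ _ (fun x : free_part n => val x h : bool) [set b]).
  by split; [exact: discrete_open|exact: discrete_closed].
exact: continuous_coord.
Qed.

Lemma continuous_free_shift g : continuous (@free_shift n g).
Proof.
apply: continuous_comp_initial => x.
have F : Filter ((set_val \o @free_shift n g) y @[y --> x]).
  apply: fmap_filter; exact: nbhs_filter.
apply/cvg_sup => h.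
move: x {F}; apply: continuous_comp_initial => x.
exact: (@continuous_coord (g + h)).
Qed.

(** The clopen cover needed by the greedy algorithm consists of cylinders, of which
    there are countably many. Freeness gives for every [x] and every [v != 0] a
    place [h] where [x] and its shift by [v] differ; the cylinder that records the
    values of [x] at [h] and [v + h], for all short [v], is disjoint from its
    short shifts. *)
Lemma clopen_separated_covering (s : nat) : exists D : set (free_part n),
  [/\ clopen D,
    forall v x, v != 0 -> (sup_norm v <= s)%N -> D x -> ~ D (free_shift v x) &
    forall x, exists2 v, (sup_norm v <= s)%N & D (free_shift v x)].
Proof.
have [w wP] := sup_norm_ball n s; pose r := [seq v <- w | v != 0].
have rP v : (v \in r) = (v != 0) && (sup_norm v <= s)%N by rewrite mem_filter wP.
pose cylinder (u : seq ('rV[int]_n * bool)) : set (free_part n) :=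
  [set x | forall c, c \in u -> val x c.1 = c.2].
have cylinder_clopen u : clopen (cylinder u).
  apply: (@clopen_determined _ _ u (fun c => [set x : free_part n | val x c.1 = c.2])).
    by move=> c _; exact: clopen_coord.
  by move=> x y xy xu c cu; apply/(xy c cu); exact: xu.
pose indep (u : seq ('rV[int]_n * bool)) :=
  forall v x, v \in r -> cylinder u x -> ~ cylinder u (free_shift v x).
pose U k : set (free_part n) :=
  [set x | exists u, [/\ choice.unpickle k = Some u, indep u & cylinder u x]].
have [D [Dclopen Dindep Dmax]] : exists D : set (free_part n), [/\ clopen D,
    forall i x, i \in r -> D x -> ~ D (free_shift i x) &
    forall x, D x \/ exists2 i, i \in r & D (free_shift i x)].
  apply: (@clopen_maximal_independent _ _ r (@free_shift n) -%R U).
  - by move=> v _; exact: continuous_free_shift.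
  - move=> v; rewrite !rP oppr_eq0 sup_normN => ->; split=> // x.
    by rewrite -free_shiftD addNr free_shift0.
  - move=> k; have [[u uk iu]|no_u] := pselect (exists2 u,
      choice.unpickle k = Some u & indep u).
      rewrite (_ : U k = cylinder u)//.
      apply/seteqP; split=> x; last by exists u.
      by case=> u' [+ _]; rewrite uk => -[<-].
    rewrite (_ : U k = set0); first exact: clopen0.
    by apply/seteqP; split=> x // [u [uk iu _]]; apply: no_u; exists u.
  - move=> k v x vr [u [uk iu xu]] [u' []]; rewrite uk => -[<-] _.
    exact: iu vr xu.
  move=> x.
  have distinguish v : exists h, v != 0 -> val x h <> val x (v + h).
    have [->|v0] := eqVneq v 0; first by exists 0.
    apply: contrapT => same; have /set_mem/(_ v (elimN eqP v0)) := valP x; apply.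
    apply/funext => h; apply: contrapT => xh; apply: same; exists h => _ E.
    by apply: xh; rewrite /bernoulli_shift.
  have [h hP] := choice distinguish.
  pose u := flatten [seq [:: (h v, val x (h v)); (v + h v, val x (v + h v))] | v <- r].
  have uP y v : v \in r -> cylinder u y ->
      val y (h v) = val x (h v) /\ val y (v + h v) = val x (v + h v).
    move=> vr yu; split.
      apply: (yu (h v, val x (h v))); apply/flatten_mapP; exists v => //.
      by rewrite !inE eqxx.
    apply: (yu (v + h v, val x (v + h v))); apply/flatten_mapP; exists v => //.
    by rewrite !inE eqxx orbT.
  exists (choice.pickle u), u; split; [exact: choice.pickleK| |].
    move=> v y vr /(uP _ _ vr)[_ y2] /(uP _ _ vr)[y1 _].
    have /andP[v0 _] : (v != 0) && (sup_norm v <= s)%N by rewrite -rP.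
    by apply: (hP v v0); rewrite -y1 -y2.
  by move=> c /flatten_mapP[v _]; rewrite !inE => /orP[] /eqP ->.
exists D; split => //.
  by move=> v x v0 vs; apply: Dindep; rewrite rP v0.
move=> x; have [Dx|[v]] := Dmax x; last first.
  by rewrite rP => /andP[_ vs]; exists v.
exists 0; last by rewrite free_shift0.
by have /eqP -> : sup_norm (0 : 'rV[int]_n) == 0%N by rewrite sup_norm_eq0.
Qed.

End FreePart.

(** The marked points read off the orbits from a clopen set of centres; every
    nonzero direction of norm at most [e] is handled at once. *)
Lemma clopen_line_marker (n e : nat) : (0 < n)%N -> (0 < e)%N ->
  exists (Delta : nat) (M : set (free_part n)),
    [/\ (e <= Delta)%N, clopen M,
        forall (g : 'rV[int]_n) x, g != 0 -> (sup_norm g <= e)%N ->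
          M x -> ~ M (free_shift g x)
      & forall (g : 'rV[int]_n) x, g != 0 -> (sup_norm g <= e)%N ->
          exists2 a : nat, (a <= Delta)%N & M (free_shift (a%:Z *: g) x)].
Proof.
move=> n0 e0.
have [phi [m [m_pr m_large phi_nz]]] := phase_parameters n e.
have [s [l [s0 es ml [el [ls lW]]]]] := scale_parameters m n0 e0.
have [D [Dclopen Dsep Dcov]] := clopen_separated_covering n s.
pose trace x : set 'rV[int]_n := fun p => D (free_shift p x).
pose M := [set x | marked phi m (n * s ^ 2) e (trace x) 0].
have trace_shift g x : trace (free_shift g x) = fun p => trace x (p + g).
  by apply/funext => p; rewrite /trace free_shiftD.
have M_shift g x : M (free_shift g x) <-> marked phi m (n * s ^ 2) e (trace x) g.
  by rewrite /M /= trace_shift; exact: marked_translate.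
have sepD x : separated s (trace x).
  move=> p q Dp Dq pq; apply: contrapT => pNq.
  have pq0 : p - q != 0 by rewrite subr_eq0; apply/eqP.
  by apply: (Dsep _ _ pq0 pq Dq); rewrite -free_shiftD subrK.
have covD x : covering s (trace x).
  move=> y; have [v vs Dv] := Dcov (free_shift y x).
  exists (v + y); first by rewrite /trace free_shiftD.
  by rewrite opprD addrCA subrr addr0 sup_normN.
exists (2 * block_count n * l)%N, M; split.
- by apply: leq_trans el _; rewrite leq_pmull.
- have [w wP] := sup_norm_ball n (n * s ^ 2 + e).
  apply: (@clopen_determined _ _ w (fun p => free_shift p @^-1` D)).
    by move=> p _; apply: preimage_clopen => //; exact: continuous_free_shift.
  move=> x y xy; apply: marked_local => p pw.
  by apply: xy; rewrite wP.
- move=> g x g0 ge Mx /M_shift.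
  rewrite -[g in X in X -> _]add0r.
  exact: (marked_far m_pr m_large phi_nz s0 (sepD x) (covD x) g0 ge Mx).
- move=> g x g0 ge.
  have [t tl mt] := marked_on_line m_pr m_large phi_nz s0 (sepD x) (covD x) 0 g0
    ge es ml ls lW.
  by exists t => //; apply/M_shift; rewrite -[_ *: _]add0r.
Qed.

Theorem theorem1p3 (n d : nat) (n_gt0 : (0 < n)%N) (d_gt0 : (0 < d)%N)
    (S : set 'rV[int]_n) (S_finite : finite_set S)
    (S_gen : generated_subgroup S = [set: 'rV[int]_n])
    (S_supp : forall g, S g ->
      #|coord_support g| = 1%N \/ #|coord_support g| = n) :
  exists (Delta : nat) (M : set (free_part n)),
    [/\ (0 < Delta)%N, (d <= Delta)%N, clopen M,
        forall x y : free_part n,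
          M x -> M y -> x <> y -> shift_orbit x y -> (d <= rho x y)%N
      & forall (g : 'rV[int]_n) (x : free_part n), S g ->
          exists a b : nat,
            [/\ (a <= Delta)%N, (b <= Delta)%N,
                M (free_shift (a%:Z *: g) x)
              & M (free_shift ((- b%:Z) *: g) x)]].
Proof.
(* Both values allowed for the size of the support are positive. *)
have S_neq0 g : S g -> g != 0.
  move=> Sg; apply/eqP => g0; have : #|coord_support g| = 0%N.
    by apply: eq_card0 => i; rewrite g0 !inE mxE eqxx.
  by case: (S_supp g Sg) => ->; lia.
have [/= r SE] := (finite_seqP S).1 S_finite.
pose e := maxn d (\max_(g <- r) sup_norm g).
have de : (d <= e)%N by exact: leq_maxl.
have Se g : S g -> (sup_norm g <= e)%N.
  rewrite SE => gr; apply: leq_trans (leq_maxr _ _).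
  exact: (@leq_bigmax_seq _ r xpredT (@sup_norm n)).
have [Delta [M [eDelta Mclopen Msep Mhit]]] :=
  clopen_line_marker n_gt0 (leq_trans d_gt0 de).
exists Delta, M; split => //.
- exact: leq_trans (leq_trans d_gt0 de) eDelta.
- exact: leq_trans de eDelta.
- move=> x y Mx + + [g _ gE]; rewrite -gE => My xy.
  rewrite rho_shift leqNgt; apply/negP => gd.
  have g0 : g != 0.
    by apply/eqP => g0; apply: xy; rewrite g0 free_shift0.
  exact: (Msep g x g0 (leq_trans (ltnW gd) de) Mx My).
- move=> g x Sg.
  have [a aD Ma] := Mhit g x (S_neq0 g Sg) (Se g Sg).
  (* A forward hit from the point `Delta` steps back is a backward hit from `x`. *)
  have [c cD Mc] := Mhit g (free_shift (- Delta%:Z *: g) x) (S_neq0 g Sg) (Se g Sg).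
  exists a, (Delta - c)%N; split => //; first exact: leq_subr.
  move: Mc; rewrite -free_shiftD -scalerDl.
  by congr (M (free_shift (_ *: g) x)); lia.
Qed.
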